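(* For an algebra $\mathcal{B}$ in a functional language $\mathtt{L}$ the following conditions are equivalent: 1) $\mathcal{B}$ is $\mathrm{u}_\omega$-compact; 2) for any finite set $X$, any system of equations $S\subseteq\mathrm{At}_{\mathtt{L}}(X)$, and any consequence $c$ of $S$ over $\mathcal{B}$ of the form $c=(t_1=s_1)\vee\ldots\vee(t_m=s_m)$, with $t_i,s_i$ terms of $\mathtt{L}$ in variables $X$, there exists a finite subsystem $S_c\subseteq S$ such that $c$ is a consequence of $S_c$ over $\mathcal{B}$; 3) for any finite set $X=\{x_1,\dots,x_n\}$, any subset $S\subseteq\mathrm{At}_{\mathtt{L}}(X)$, and any atomic formulas $(t_1=s_1),\ldots,(t_m=s_m)\in\mathrm{At}_{\mathtt{L}}(X)$, if the (infinite) formula $$\forall x_1\ldots\forall x_n\Big(\bigwedge_{(t=s)\in S}t(\bar x)=s(\bar x)\;\longrightarrow\;\bigvee_{i=1}^m t_i(\bar x)=s_i(\bar x)\Big)$$ holds in $\mathcal{B}$, then for some finite subsystem $S_c\subseteq S$ the universal sentence $$\forall x_1\ldots\forall x_n\Big(\bigwedge_{(t=s)\in S_c}t(\bar x)=s(\bar x)\;\longrightarrow\;\bigvee_{i=1}^m t_i(\bar x)=s_i(\bar x)\Big)$$ also holds in $\mathcal{B}$; 4) for any finite set $X$, any subset $S\subseteq\mathrm{At}_{\mathtt{L}}(X)$, and any atomic formulas $(t_1=s_1),\ldots,(t_m=s_m)\in\mathrm{At}_{\mathtt{L}}(X)$, if the set of formulas $T=S\cup\{\neg(t_1=s_1),\ldots,\neg(t_m=s_m)\}$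 is finitely satisfiable in $\mathcal{B}$, then it is satisfiable in $\mathcal{B}$; 5) every finitely generated algebra from $\mathbf{Ucl}(\mathcal{B})$ is the coordinate algebra of an irreducible algebraic set over $\mathcal{B}$; 6) $\mathbf{Ucl}(\mathcal{B})_\omega=\mathbf{Dis}(\mathcal{B})_\omega$; 7) $\mathbf{Ucl}(\mathcal{B})=\mathbf{L_{fg}}\mathbf{Dis}(\mathcal{B})$.
   Context: A functional language $\mathtt{L}$ is a first-order language with function and constant symbols only (and equality); $\mathtt{L}$-structures are called $\mathtt{L}$-algebras. For a finite set of variables $X=\{x_1,\dots,x_n\}$, $\mathcal{T}_{\mathtt{L}}(X)$ is the absolutely free algebra of terms, and $\mathrm{At}_{\mathtt{L}}(X)$ is the set of atomic formulas $(t=s)$ in variables $X$ (equations). A system of equations is a subset $S\subseteq \mathrm{At}_{\mathtt{L}}(X)$; $\mathrm{V}_{\mathcal{B}}(S)\subseteq B^n$ is its solution set in $\mathcal{B}$; sets of this form are the algebraic sets over $\mathcal{B}$. An algebraic set is irreducible if it is non-empty and is not a finite union of proper algebraic subsets. A quantifier-free formula $\phi$ in variables $X$ is a consequence of $S$ over $\mathcal{B}$ if $\mathcal{B}\models\phi(b_1,\dots,b_n)$ for all $(b_1,\dots,b_n)\in\mathrm{V}_{\mathcal{B}}(S)$. The radical $\mathrm{Rad}(Y)$ of an algebraic set $Y\subseteq B^n$ is the set of all $(t=s)\in\mathrm{At}_{\mathtt{L}}(X)$ holding at all points of $Y$, and the coordinate algebra of $Y$ is $\Gamma(Y)=\mathcal{T}_{\mathtt{L}}(X)/\theta_{\mathrm{Rad}(Y)}$,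 where $t_1\sim t_2$ iff $(t_1=t_2)\in\mathrm{Rad}(Y)$ (being the coordinate algebra of $Y$ is understood up to isomorphism). $\mathcal{B}$ is $\mathrm{u}_\omega$-compact if for any finite $X$, any $S\subseteq\mathrm{At}_{\mathtt{L}}(X)$ and any equations $(t_1=s_1),\dots,(t_m=s_m)\in\mathrm{At}_{\mathtt{L}}(X)$ with $\mathrm{V}_{\mathcal{B}}(S)\subseteq \mathrm{V}_{\mathcal{B}}(t_1=s_1)\cup\dots\cup\mathrm{V}_{\mathcal{B}}(t_m=s_m)$ there is a finite $S_0\subseteq S$ with $\mathrm{V}_{\mathcal{B}}(S_0)\subseteq \mathrm{V}_{\mathcal{B}}(t_1=s_1)\cup\dots\cup\mathrm{V}_{\mathcal{B}}(t_m=s_m)$. A set of formulas is satisfiable in $\mathcal{B}$ if elements of $\mathcal{B}$ can be assigned to its variables making all its formulas true; finitely satisfiable if each finite subset is satisfiable in $\mathcal{B}$. $\mathbf{Ucl}(\mathcal{B})$ is the class of models of all universal sentences true in $\mathcal{B}$. $\mathbf{Dis}(\mathcal{B})$ is the class of algebras discriminated by $\mathcal{B}$: $\mathcal{C}$ is discriminated by $\mathcal{B}$ if for any finite $W\subseteq C$ there is a homomorphism $h\colon\mathcal{C}\to\mathcal{B}$ injective on $W$ (by convention, the trivial one-element algebra is discriminated by $\mathcal{B}$ iff $\mathcal{B}$ has a trivial subalgebra). For a class $\mathbf{K}$, $\mathbf{K}_\omega$ is the class of finitely generated algebras from $\mathbf{K}$, and $\mathbf{L_{fg}}(\mathbf{K})$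 is the class of algebras all of whose finitely generated subalgebras belong to $\mathbf{K}$. *)

(* Defs.v *)
From HB Require Import structures.
From mathcomp Require Import all_boot.
From mathcomp Require Import boolp classical_sets functions cardinality.

Set Implicit Arguments.
Unset Strict Implicit.
Unset Printing Implicit Defensive.

Local Open Scope classical_set_scope.
Local Open Scope quotient_scope.

(* Constant symbols are the function symbols of arity 0. *)
Record language := Language {
  symbol :> Type;
  arity : symbol -> nat
}.
Arguments arity {l}.

(* A structure may be empty, so that T_L(X) and its quotients are structures
   even when X is empty and L has no constant; an algebra is non-empty. *)
Record structure (L : language) := Structure {
  carrier :> Type;
  interp : forall f : L, ('I_(arity f) -> carrier) -> carrier
}.
Arguments Structure {L}.
Arguments interp {L s}.

Record algebra (L : language) := Algebra {
  algebra_structure :> structure L;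
  algebra_nonempty : inhabited algebra_structure
}.
Arguments Algebra {L}.

Section Morphisms.
Context {L : language}.
Implicit Types A B : structure L.

Definition is_hom A B (h : A -> B) : Prop :=
  forall (f : L) (a : 'I_(arity f) -> A), h (interp f a) = interp f (h \o a).

Definition isomorphic A B : Prop :=
  exists h : A -> B, is_hom h /\ bijective h.

End Morphisms.

Section Subalgebras.
Context {L : language}.

Definition subuniverse (A : structure L) (P : set A) : Prop :=
  forall (f : L) (a : 'I_(arity f) -> A), (forall i, P (a i)) -> P (interp f a).

Definition finitely_generated (A : structure L) : Prop :=
  exists W : set A, finite_set W /\ smallest (@subuniverse A) W = setT.

Definition substructure (A : structure L) (P : set A) (subP : subuniverse P) :
    structure L :=
  Structure {x : A | P x} (fun f a =>
    exist P (interp f (fun i => sval (a i))) (subP f _ (fun i => svalP (a i)))).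

Lemma substructure_nonempty (A : structure L) (P : set A)
    (subP : subuniverse P) : P !=set0 -> inhabited (substructure subP).
Proof. by case=> x Px; apply: inhabits; exists x. Qed.

Definition subalgebra (A : structure L) (P : set A) (subP : subuniverse P)
    (P0 : P !=set0) : algebra L :=
  Algebra (substructure subP) (substructure_nonempty subP P0).

End Subalgebras.

(* Terms in the variables x_i, i : 'I_n. *)
Inductive term (L : language) (n : nat) : Type :=
| Var of 'I_n
| App (f : L) of ('I_(arity f) -> term L n).
Arguments Var {L n}.
Arguments App {L n}.

Definition term_structure (L : language) (n : nat) : structure L :=
  Structure (term L n) App.

(* The pair (t, s) is the atomic formula t = s. *)
Definition equation (L : language) (n : nat) : Type := (term L n * term L n)%type.

Inductive qf_formula (L : language) (n : nat) : Type :=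
| QTrue
| QEq of equation L n
| QNot of qf_formula L n
| QAnd of qf_formula L n & qf_formula L n
| QOr of qf_formula L n & qf_formula L n
| QImp of qf_formula L n & qf_formula L n.
Arguments QTrue {L n}.
Arguments QEq {L n}.
Arguments QNot {L n}.
Arguments QAnd {L n}.
Arguments QOr {L n}.
Arguments QImp {L n}.

Section BigConnectives.
Context {L : language} {n : nat}.

Definition conjunction (k : nat) (e : 'I_k -> equation L n) : qf_formula L n :=
  \big[QAnd/QTrue]_(i < k) QEq (e i).

Fixpoint disjunction (m : nat) : ('I_m.+1 -> equation L n) -> qf_formula L n :=
  match m with
  | 0 => fun e => QEq (e ord0)
  | m'.+1 => fun e => QOr (QEq (e ord0)) (disjunction (fun i => e (lift ord0 i)))
  end.

End BigConnectives.

(* [Forall phi] is the sentence "forall x_1 ... x_n, phi". *)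
Record universal_sentence (L : language) := Forall {
  nb_vars : nat;
  matrix_of : qf_formula L nb_vars
}.
Arguments Forall {L nb_vars}.

Section Semantics.
Context {L : language}.

Fixpoint eval (A : structure L) n (b : 'I_n -> A) (t : term L n) : A :=
  match t with
  | Var i => b i
  | App f ts => interp f (fun i => eval b (ts i))
  end.

Definition holds (A : structure L) n (b : 'I_n -> A) (q : equation L n) : Prop :=
  eval b q.1 = eval b q.2.

Fixpoint sat (A : structure L) n (b : 'I_n -> A) (phi : qf_formula L n) : Prop :=
  match phi with
  | QTrue => True
  | QEq q => holds b q
  | QNot psi => ~ sat b psi
  | QAnd psi chi => sat b psi /\ sat b chi
  | QOr psi chi => sat b psi \/ sat b chi
  | QImp psi chi => sat b psi -> sat b chi
  end.

Definition models (A : structure L) (u : universal_sentence L) : Prop :=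
  forall b : 'I_(nb_vars u) -> A, sat b (matrix_of u).

Definition satisfiable (A : structure L) n (T : set (qf_formula L n)) : Prop :=
  exists b : 'I_n -> A, forall phi, T phi -> sat b phi.

Definition finitely_satisfiable (A : structure L) n
    (T : set (qf_formula L n)) : Prop :=
  forall T0, finite_set T0 -> T0 `<=` T -> satisfiable A T0.

End Semantics.

Section AlgebraicSets.
Context {L : language}.

Definition solutions (B : structure L) n (S : set (equation L n)) :
    set ('I_n -> B) :=
  [set b | forall q, S q -> holds b q].
Arguments solutions B {n} S.

Definition consequence (B : structure L) n (S : set (equation L n))
    (phi : qf_formula L n) : Prop :=
  forall b, solutions B S b -> sat b phi.

Definition algebraic (B : structure L) n (Y : set ('I_n -> B)) : Prop :=
  exists S : set (equation L n), Y = solutions B S.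

Definition irreducible (B : structure L) n (Y : set ('I_n -> B)) : Prop :=
  Y !=set0 /\
  forall (k : nat) (Z : 'I_k -> set ('I_n -> B)),
    (forall i, algebraic (Z i) /\ Z i `<` Y) ->
    Y <> \bigcup_(i in [set: 'I_k]) Z i.

Definition radical (B : structure L) n (Y : set ('I_n -> B)) :
    set (equation L n) :=
  [set q | forall b, Y b -> holds b q].

End AlgebraicSets.
Arguments solutions {L} B {n} S.

Section CoordinateAlgebra.
Context {L : language} {B : structure L} {n : nat} (Y : set ('I_n -> B)).

Definition theta : rel {classic term L n} := fun t s => `[< radical Y (t, s) >].

Lemma theta_refl : reflexive theta.
Proof. by move=> t; apply/asboolP. Qed.

Lemma theta_sym : symmetric theta.
Proof. by move=> t s; apply: asbool_equiv_eq; split=> r b Yb; rewrite /holds r. Qed.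

Lemma theta_trans : transitive theta.
Proof.
move=> t s u /asboolP st /asboolP tu; apply/asboolP => b Yb.
exact: etrans (st b Yb) (tu b Yb).
Qed.

Canonical theta_equiv := EquivRel theta theta_refl theta_sym theta_trans.

(* The operations are computed on representatives; by [coordinate_pi_hom] this
   is the quotient structure. *)
Definition coordinate_algebra : structure L :=
  Structure {eq_quot theta_equiv} (fun f a =>
    \pi_{eq_quot theta_equiv} (App f (fun i => repr (a i)))).

Lemma coordinate_pi_hom :
  @is_hom L (term_structure L n) coordinate_algebra
    (fun t => \pi_{eq_quot theta_equiv} t).
Proof.
move=> f a; apply/eqmodP/asboolP => b Yb; rewrite /holds /=.
congr (interp f _); apply/funext => i.
have /eqmodP/asboolP/(_ b Yb) // :
  a i = repr (\pi_{eq_quot theta_equiv} (a i)) %[mod {eq_quot theta_equiv}].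
by rewrite reprK.
Qed.

End CoordinateAlgebra.

Section Classes.
Context {L : language}.

Definition u_omega_compact (B : algebra L) : Prop :=
  forall (n : nat) (S : set (equation L n)) (m : nat)
         (e : 'I_m.+1 -> equation L n),
    solutions B S `<=` \bigcup_(i in [set: 'I_m.+1]) solutions B [set e i] ->
    exists S0 : set (equation L n),
      [/\ finite_set S0, S0 `<=` S &
          solutions B S0 `<=`
            \bigcup_(i in [set: 'I_m.+1]) solutions B [set e i]].

Definition Ucl (B C : algebra L) : Prop :=
  forall u : universal_sentence L, models B u -> models C u.

(* For C trivial this says that B has a trivial subalgebra. *)
Definition Dis (B C : algebra L) : Prop :=
  forall W : set C, finite_set W ->
    exists h : C -> B, is_hom h /\ set_inj W h.

Definition fg_members (K : algebra L -> Prop) (C : algebra L) : Prop :=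
  K C /\ finitely_generated C.

Definition Lfg (K : algebra L -> Prop) (C : algebra L) : Prop :=
  forall (P : set C) (subP : subuniverse P) (P0 : P !=set0),
    finitely_generated (subalgebra subP P0) -> K (subalgebra subP P0).

Definition same_class (K1 K2 : algebra L -> Prop) : Prop :=
  forall C : algebra L, K1 C <-> K2 C.

End Classes.

(* Main.v *)
(* If a system S of equations and finitely many inequations are finitely
   satisfiable in B, they are satisfiable in some C in Ucl(B), namely an
   ultrapower of B indexed by the points of B^n. When the subalgebra of C
   generated by the solution is discriminated by B, a homomorphism to B that is
   injective on the finitely many sides of the inequations brings the solution
   back to B: this gives 7) => 4).
   Conversely, let C in Ucl(B) be generated by a tuple c, and let Y be the set of
   points of B satisfying all the equations true at c. Finitely many equations
   true at c and finitely many equations false at c can always be realized in B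
   accordingly, so by 4) any finitely many equations false at c are all false at
   some point of Y. Hence Rad(Y) is the set of equations true at c, Y is
   irreducible, and C is the coordinate algebra of Y. The evaluations at the
   points of an irreducible Y discriminate its coordinate algebra, because a
   finite set on which none of them is injective would cover Y by finitely many
   proper algebraic subsets. *)

Require Import Defs.
From mathcomp Require Import all_boot.
From mathcomp Require Import boolp classical_sets functions cardinality filter.

Set Implicit Arguments.
Unset Strict Implicit.
Unset Printing Implicit Defensive.

Local Open Scope classical_set_scope.
Local Open Scope quotient_scope.

Lemma finite_set_range (T : Type) (A : set T) :
  finite_set A -> exists (k : nat) (r : 'I_k -> T), range r = A.
Proof.
move=> /(@finite_seqP {classic T})[s ->].
exists (size s), (tnth (in_tuple s)); apply/seteqP; split=> [_ [i _ <-]|x /= xs].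
  exact: (mem_tnth i (in_tuple s)).
by have /tnthP[i ->] : x \in in_tuple s by []; exists i.
Qed.

Lemma finite_range (k : nat) (T : Type) (r : 'I_k -> T) : finite_set (range r).
Proof. exact: finite_image. Qed.

(** * Satisfaction and its transfer along homomorphisms *)

Section Satisfaction.
Context {L : language}.
Implicit Types A B C : structure L.

Lemma sat_bigand A n (b : 'I_n -> A) k (phi : 'I_k -> qf_formula L n) :
  sat b (\big[QAnd/QTrue]_(i < k) phi i) <-> forall i, sat b (phi i).
Proof.
elim: k phi => [|k IH] phi; first by rewrite big_ord0; split=> // _ [].
rewrite big_ord_recl /= IH; split=> [[h0 h] i|h]; last by split=> [|i]; apply: h.
by have [j ->|->] := unliftP ord0 i.
Qed.

Lemma sat_disjunction A n (b : 'I_n -> A) m (e : 'I_m.+1 -> equation L n) :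
  sat b (disjunction e) <-> exists i, holds b (e i).
Proof.
elim: m e => [|m IH] e /=.
  by split=> [h|[i]]; [exists ord0 | rewrite ord1].
rewrite IH; split=> [[h|[i h]]|[i]]; [by exists ord0|by exists (lift ord0 i)|].
by have [j ->|->] := unliftP ord0 i => h; [right; exists j|left].
Qed.

Lemma subset_bigcup_solutions B n (S : set (equation L n)) m
    (e : 'I_m.+1 -> equation L n) :
  solutions B S `<=` \bigcup_(i in [set: 'I_m.+1]) solutions B [set e i] <->
  consequence B S (disjunction e).
Proof.
split=> h b /h => [[i _ bi]|/sat_disjunction[i bi]].
  by apply/sat_disjunction; exists i; apply: bi.
by exists i => // _ ->.
Qed.

Lemma eval_hom A B (h : A -> B) n (a : 'I_n -> A) (t : term L n) :
  is_hom h -> h (eval a t) = eval (h \o a) t.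
Proof.
move=> hh; elim: t => //= f ts IH; rewrite hh; congr (interp f _).
exact/funext.
Qed.

Lemma holds_hom A B (h : A -> B) n (a : 'I_n -> A) (q : equation L n) :
  is_hom h -> holds a q -> holds (h \o a) q.
Proof. by move=> hh; rewrite /holds -!eval_hom // => ->. Qed.

(** Homomorphisms always preserve equations; injectivity on this finite set makes them also reflect
    the equations occurring in [phi]. *)
Fixpoint sides A n (a : 'I_n -> A) (phi : qf_formula L n) : set A :=
  match phi with
  | QTrue => set0
  | QEq q => [set eval a q.1; eval a q.2]
  | QNot psi => sides a psi
  | QAnd psi chi | QOr psi chi | QImp psi chi => sides a psi `|` sides a chi
  end.

Lemma finite_sides A n (a : 'I_n -> A) phi : finite_set (sides a phi).
Proof.
by elim: phi => //= *; rewrite finite_setU; split.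
Qed.

Lemma sat_hom A B (h : A -> B) n (a : 'I_n -> A) phi :
  is_hom h -> set_inj (sides a phi) h -> sat (h \o a) phi <-> sat a phi.
Proof.
move=> hh; elim: phi => //= [q|phi IH|phi IH psi IH'|phi IH psi IH'|phi IH psi IH'].
- move=> hinj; split=> [|/holds_hom]; last exact.
  by rewrite /holds -!eval_hom //; apply: hinj; rewrite inE; [left|right].
- by move=> /IH ->.
all: move=> hinj; rewrite IH ?IH' // => x y; rewrite !inE => xs ys;
  apply: hinj; rewrite inE; by [left|right].
Qed.

Lemma sat_hom_inj A B (h : A -> B) n (a : 'I_n -> A) phi :
  is_hom h -> injective h -> sat (h \o a) phi <-> sat a phi.
Proof. by move=> hh hinj; apply: sat_hom => // x y _ _; apply: hinj. Qed.

Fixpoint rename n m (g : 'I_n -> 'I_m) (t : term L n) : term L m :=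
  match t with
  | Var i => Var (g i)
  | App f ts => App f (fun i => rename g (ts i))
  end.

Lemma eval_rename A n m (g : 'I_n -> 'I_m) (b : 'I_m -> A) t :
  eval b (rename g t) = eval (b \o g) t.
Proof. by elim: t => //= f ts IH; congr (interp f _); apply/funext. Qed.

End Satisfaction.

(** * Generated substructures *)

Section Subalgebras.
Context {L : language}.
Implicit Types A B C : structure L.

Lemma smallest_subuniverse A (W : set A) :
  subuniverse (smallest (@subuniverse L A) W).
Proof. by move=> f a ha Q QW; apply: QW.1 => i; apply: (ha i Q QW). Qed.

Lemma eval_subuniverse A (P : set A) n (a : 'I_n -> A) (t : term L n) :
  subuniverse P -> (forall i, P (a i)) -> P (eval a t).
Proof. by move=> sP Pa; elim: t => [i|f ts IH] /=; [exact: Pa|exact: sP]. Qed.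

Lemma sval_injective A (P : set A) (subP : subuniverse P) :
  injective (sval : substructure subP -> A).
Proof.
move=> [x Px] [y Py] /= xy; move: Py; rewrite -xy => Py.
by rewrite (Prop_irrelevance Px Py).
Qed.

Lemma sat_substructure A (P : set A) (subP : subuniverse P) n
    (a : 'I_n -> substructure subP) phi :
  sat (fun i => sval (a i)) phi <-> sat a phi.
Proof. exact: (sat_hom_inj a phi _ (@sval_injective A P subP)). Qed.

Lemma finitely_generated_smallest A (W : set A) :
  finite_set W -> finitely_generated (substructure (@smallest_subuniverse A W)).
Proof.
move=> finW; pose D := substructure (@smallest_subuniverse A W).
exists ((sval : D -> A) @^-1` W); split.
  by apply: finite_preimage => // x y _ _; apply: sval_injective.
apply/seteqP; split=> // -[x Px] _ Q [subQ WQ].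
(* [R] is the image of [Q] in [A]: a subuniverse of [A] containing [W], so it contains all that [W]
   generates. *)
pose R :=
  [set y | exists Py : smallest (@subuniverse L A) W y, Q (exist _ y Py)].
suff /(Px R)[Px' QPx'] : subuniverse R /\ W `<=` R.
  by rewrite (Prop_irrelevance Px Px').
split=> [f a Ra|y Wy]; last by exists (sub_gen_smallest Wy); apply: WQ.
pose a' i : D := exist _ (a i) (projT1 (cid (Ra i))).
have /subQ Qa' : forall i, Q (a' i) by move=> i; rewrite /a'; case: cid.
by exists (svalP (interp f a')); move: Qa'; congr Q; apply: sval_injective.
Qed.

End Subalgebras.

Lemma finitely_generated_eval (L : language) (A : structure L) :
  finitely_generated A -> exists (n : nat) (a : 'I_n -> A),
    forall x, exists t : term L n, eval a t = x.
Proof.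
case=> W [/finite_set_range[n [a <-]] genA]; exists n, a => x.
have : smallest (@subuniverse L A) (range a) x by rewrite genA.
move=> /(_ [set x | exists t, eval a t = x]); apply.
split=> [f b hb|_ [i _ <-]]; last by exists (Var i).
exists (App f (fun i => projT1 (cid (hb i)))) => /=.
by congr (interp f _); apply/funext => i; case: cid.
Qed.

(** * Coordinate algebras *)

Section CoordinateAlgebra.
Context {L : language} {B : structure L} {n : nat} (Y : set ('I_n -> B)).
Local Notation pi t := (\pi_{eq_quot (theta_equiv Y)} t).

Lemma coordinate_eqP (t s : term L n) : pi t = pi s <-> radical Y (t, s).
Proof. by split=> [/eqmodP/asboolP|rts]; last by apply/eqmodP/asboolP. Qed.

Lemma radical_repr (t : term L n) : radical Y (repr (pi t), t).
Proof. by apply/coordinate_eqP; rewrite reprK. Qed.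

(** Equations of the radical hold at [b], so the value at [b] does not depend on the chosen
    representatives. *)
Lemma coordinate_point_hom (b : 'I_n -> B) :
  Y b -> is_hom (fun x : coordinate_algebra Y => eval b (repr x)).
Proof. by move=> Yb f a; apply: radical_repr Yb. Qed.

(** Evaluation at [c] maps the terms onto [C] with kernel [theta Y], so both sides are the same
    quotient of the term algebra. *)
Lemma isomorphic_coordinate (C : structure L) (c : 'I_n -> C) :
  (forall x, exists t, eval c t = x) ->
  (forall q, radical Y q <-> holds c q) ->
  isomorphic C (coordinate_algebra Y).
Proof.
move=> gen radE; pose tau x := projT1 (cid (gen x)).
have tauK x : eval c (tau x) = x by rewrite /tau; case: cid.
have reprE t : eval c (repr (pi t)) = eval c t.
  by have /radE := radical_repr t.
exists (fun x => pi (tau x) : coordinate_algebra Y); split=> [f a|].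
  apply/coordinate_eqP/radE; rewrite /holds tauK /=.
  by congr (interp f _); apply/funext => i; rewrite reprE tauK.
exists (fun y : coordinate_algebra Y => eval c (repr y)) => [x|y].
  by rewrite reprE tauK.
rewrite -[RHS]reprK; apply/coordinate_eqP/radE; exact: tauK.
Qed.

End CoordinateAlgebra.

(** * Ultrapowers and the theorem of Łoś *)

Section Ultrapower.
Context {L : language} {I : Type} (B : algebra L) (U : set_system I)
  {UU : UltraFilter U}.

Definition ultra_eq : rel {classic I -> B} :=
  fun u v => `[< U [set i | u i = v i] >].

Lemma ultra_eq_refl : reflexive ultra_eq.
Proof. by move=> u; apply/asboolP; apply: filterS filterT. Qed.

Lemma ultra_eq_sym : symmetric ultra_eq.
Proof. by move=> u v; apply: asbool_equiv_eq; split; apply: filterS. Qed.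

Lemma ultra_eq_trans : transitive ultra_eq.
Proof.
move=> u v w /asboolP uv /asboolP vw; apply/asboolP.
by apply: filterS2 uv vw => i /= -> ->.
Qed.

Canonical ultra_equiv :=
  EquivRel ultra_eq ultra_eq_refl ultra_eq_sym ultra_eq_trans.

Definition ultrapower_structure : structure L :=
  Structure {eq_quot ultra_equiv} (fun f a =>
    \pi_{eq_quot ultra_equiv} (fun i => interp f (fun j => repr (a j) i))).

Definition ultra_class (u : I -> B) : ultrapower_structure :=
  \pi_{eq_quot ultra_equiv} u.

Definition ultra_repr (x : ultrapower_structure) : I -> B := repr x.

Lemma ultra_classK x : ultra_class (ultra_repr x) = x.
Proof. exact: reprK. Qed.

Lemma ultra_classP u v :
  ultra_class u = ultra_class v <-> U [set i | u i = v i].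
Proof. by split=> [/eqmodP/asboolP|h]; last by apply/eqmodP/asboolP. Qed.

Lemma ultrapower_nonempty : inhabited ultrapower_structure.
Proof.
by case: (algebra_nonempty B) => x; exists; exact: (ultra_class (fun=> x)).
Qed.

Definition ultrapower : algebra L :=
  Algebra ultrapower_structure ultrapower_nonempty.

Lemma ultra_eval n (c : 'I_n -> I -> B) (t : term L n) :
  eval (fun j => ultra_class (c j)) t =
  ultra_class (fun i => eval (c ^~ i) t).
Proof.
elim: t => //= f ts IH; apply/ultra_classP.
apply: filterS (_ : U [set i | forall j,
    ultra_repr (ultra_class (fun i => eval (c ^~ i) (ts j))) i =
    eval (c ^~ i) (ts j)]).
  move=> i /= h; congr (interp f _); apply/funext => j; rewrite IH; exact: h.
(* Arities are finite, so only finitely many members of [U] are intersected. *)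
apply: filter_forall => j; apply/ultra_classP; exact: ultra_classK.
Qed.

Lemma ultra_not (P : set I) : ~ U P <-> U (~` P).
Proof.
split=> [nUP|UnP UP]; first by have [] := in_ultra_setVsetC P UU.
by apply: (@filter_not_empty _ U); rewrite -(setICr P); apply: filterI.
Qed.

(** The theorem of Łoś for quantifier-free formulas. Negation, disjunction and implication use that
    [U] contains each set or its complement. *)
Lemma ultra_sat n (c : 'I_n -> I -> B) phi :
  sat (fun j => ultra_class (c j)) phi <-> U [set i | sat (c ^~ i) phi].
Proof.
have andE (P Q : set I) : U (P `&` Q) <-> U P /\ U Q.
  by split=> [h|[]]; [split; apply: filterS h => ? []|exact: filterI].
elim: phi => [|q|phi IH|phi IH psi IH'|phi IH psi IH'|phi IH psi IH'] /=.
- by split=> // _; apply: filterS filterT.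
- by rewrite /holds !ultra_eval ultra_classP.
- by rewrite IH ultra_not.
- by rewrite IH IH' -andE.
- rewrite IH IH'; split=> [[]|h]; try by apply: filterS => i ?; by [left|right].
  have [|nphi] := in_ultra_setVsetC [set i | sat (c ^~ i) phi] UU; first by left.
  by right; apply: filterS2 h nphi => i /= [].
rewrite IH IH'; split=> h; last by move=> hphi; apply: filterS2 h hphi => i; apply.
have [/h|] := in_ultra_setVsetC [set i | sat (c ^~ i) phi] UU.
  by apply: filterS => i /= hpsi _.
by apply: filterS => i /= nphi /nphi.
Qed.

Lemma Ucl_ultrapower : Ucl B ultrapower.
Proof.
move=> [n phi] Bphi c.
have -> : c = fun j => ultra_class (ultra_repr (c j)).
  by apply/funext => j; rewrite ultra_classK.
by apply/ultra_sat; apply: filterS filterT => i _; apply: Bphi.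
Qed.

End Ultrapower.
Arguments ultrapower {L I} B U {UU}.
Arguments ultra_class {L I} B U {UU} u.

(** * Universal classes, discrimination and compactness *)

Section Classes.
Context {L : language}.
Implicit Types B C : algebra L.

(** Unsatisfiability of a finite set in [B] is a universal sentence, the negation of its
    conjunction, so it passes to [C]. *)
Lemma Ucl_satisfiable B C n (T0 : set (qf_formula L n)) :
  Ucl B C -> finite_set T0 -> satisfiable C T0 -> satisfiable B T0.
Proof.
move=> BC /finite_set_range[k [phi <-]] [c cT].
apply/not_existsP => Bn.
suff /BC/(_ c)/= : models B (Forall (QNot (\big[QAnd/QTrue]_(i < k) phi i))).
  by apply; apply/sat_bigand => i; apply: cT; exists i.
move=> b /= /sat_bigand h; apply: (Bn b) => _ [i _ <-]; exact: h.
Qed.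

Lemma Ucl_compactness B n (T : set (qf_formula L n)) :
  finitely_satisfiable B T -> exists2 C, Ucl B C & satisfiable C T.
Proof.
move=> finT.
pose models_of T0 := [set b : 'I_n -> B | forall phi, T0 phi -> sat b phi].
pose D := [set T0 | finite_set T0 /\ T0 `<=` T].
(* Finite satisfiability makes the basic sets non-empty, and a union of finite subsets of [T] gives
   an intersection of basic sets. *)
have FF : ProperFilter (filter_from D models_of).
  apply: filter_from_proper => [|T0 [finT0 T0T]]; last exact: finT.
  apply: filter_from_filter => [|T0 T1 [fin0 sub0] [fin1 sub1]].
    by exists set0; split=> //; apply: finite_set0.
  exists (T0 `|` T1); first by split; [rewrite finite_setU|rewrite subUset].
  by move=> b h; split=> phi hphi; apply: h; [left|right].
have [U [UU FU]] := ultraFilterLemma FF.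
exists (ultrapower B U); first exact: Ucl_ultrapower.
(* The coordinate functions on B^n form a generic point: [phi] holds there because [U] contains its
   solution set. *)
exists (fun j => ultra_class B U (fun b => b j)) => phi Tphi.
apply/ultra_sat/FU; exists [set phi]; last by move=> b; apply.
by split; [exact: finite_set1|move=> _ ->].
Qed.

(** A homomorphism injective on the sides of [phi] would carry a counterexample in [C] to one in
    [B]. *)
Lemma sub_Dis_Ucl B C : Dis B C -> Ucl B C.
Proof.
move=> BC [n phi] Bphi c.
have [h [hh hinj]] := BC _ (finite_sides c phi).
by apply/(sat_hom hh hinj); apply: Bphi.
Qed.

Lemma Ucl_subalgebra B C (P : set C) (subP : subuniverse P) (P0 : P !=set0) :
  Ucl B C -> Ucl B (subalgebra subP P0).
Proof.
by move=> BC [n phi] /BC Cphi c; apply: (sat_substructure c phi).1 (Cphi _).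
Qed.

(** A universal sentence is tested on one finite tuple at a time, and the tuple lies in a finitely
    generated subalgebra. *)
Lemma Lfg_Ucl B C : Lfg (Ucl B) C -> Ucl B C.
Proof.
move=> BC [n phi] Bphi c; have [x0] := algebra_nonempty C.
(* Adding [x0] keeps the generated subalgebra non-empty even for the empty tuple in a language
   without constants. *)
pose W := range c `|` [set x0].
have Wc i : smallest (@subuniverse L C) W (c i).
  by apply: sub_gen_smallest; left; exists i.
have W0 : smallest (@subuniverse L C) W !=set0.
  by exists x0; apply: sub_gen_smallest; right.
have finW : finite_set W by rewrite finite_setU; split; [exact: finite_range|].
pose c' i := exist (smallest (@subuniverse L C) W) (c i) (Wc i).
apply: (sat_substructure (subP := @smallest_subuniverse L C W) c' phi).2 _.
exact: (BC _ _ W0 (finitely_generated_smallest finW) (Forall phi) Bphi).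
Qed.

Definition equations_and_inequations n (S : set (equation L n)) m
    (e : 'I_m.+1 -> equation L n) : set (qf_formula L n) :=
  [set QEq q | q in S] `|` [set QNot (QEq (e i)) | i in [set: 'I_m.+1]].

Lemma sat_equations_and_inequations B n (S : set (equation L n)) m
    (e : 'I_m.+1 -> equation L n) (b : 'I_n -> B) :
  (forall phi, equations_and_inequations S e phi -> sat b phi) <->
  solutions B S b /\ ~ sat b (disjunction e).
Proof.
rewrite sat_disjunction; split=> [h|[Sb eb] _ [[q Sq <-]|[i _ <-]]].
- split=> [q Sq|[i]]; first by apply: (h (QEq q)); left; exists q.
  by apply: (h (QNot (QEq (e i)))); right; exists i.
- exact: Sb.
- by move=> /= bi; apply: eb; exists i.
Qed.

(* Condition 4) of the theorem. *)
Definition inequation_compact B : Prop :=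
  forall (n : nat) (S : set (equation L n)) (m : nat)
         (e : 'I_m.+1 -> equation L n),
    finitely_satisfiable B (equations_and_inequations S e) ->
    satisfiable B (equations_and_inequations S e).

Lemma inequation_compact_u_omega B : inequation_compact B -> u_omega_compact B.
Proof.
move=> compB n S m e /subset_bigcup_solutions Se; apply: contrapT => nS0.
have [|b /sat_equations_and_inequations[/Se]//] := compB n S m e.
move=> T0 finT0 T0T.
(* A solution of the equations in [T0] at which every [e i] fails would satisfy all of [T0]. *)
pose S0 := [set q | S q /\ T0 (QEq q)].
have finS0 : finite_set S0.
  apply: (@sub_finite_set _ _ (QEq @^-1` T0)); first by move=> q [].
  by apply: finite_preimage => // p q _ _ [].
apply: contrapT => nsat; apply: nS0; exists S0; split=> //; first by move=> q [].
apply/subset_bigcup_solutions => b S0b; apply: contrapT => neb.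
apply: nsat; exists b => phi T0phi.
have [[q Sq Eq]|[i _ Ei]] := T0T _ T0phi.
  by rewrite -Eq; apply: S0b; split=> //; rewrite Eq.
by rewrite -Ei => bi; apply: neb; apply/sat_disjunction; exists i.
Qed.

(* The hypothesis only concerns systems with at least one inequation; two
   fresh variables supply it. *)
Lemma inequation_compact_solution B C n (c : 'I_n -> C) :
  inequation_compact B -> Ucl B C -> solutions B (holds c) !=set0.
Proof.
move=> compB BC; have [x0] := algebra_nonempty B; have [c0] := algebra_nonempty C.
have [[[x y] /= xy]|B1] := pselect (exists xy : B * B, xy.1 <> xy.2); last first.
  (* When [B] is trivial, every equation holds at its only point. *)
  exists (fun=> x0) => q _; apply: contrapT => ?.
  by apply: B1; exists (eval (fun=> x0) q.1, eval (fun=> x0) q.2).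
pose extend (A : structure L) (a : 'I_n -> A) (a' : 'I_2 -> A)
    (i : 'I_(n + 2)) :=
  match fintype.split i with inl j => a j | inr k => a' k end.
have extendl A a a' : @extend A a a' \o @lshift n 2 = a.
  by apply/funext => i; rewrite /extend /= (unsplitK (inl i)).
have extendr A a a' k : @extend A a a' (rshift n k) = a' k.
  by rewrite /extend (unsplitK (inr k)).
pose up (q : equation L n) : equation L (n + 2) :=
  (rename (@lshift n 2) q.1, rename (@lshift n 2) q.2).
have holds_up (A : structure L) (a : 'I_(n + 2) -> A) q :
    holds a (up q) <-> holds (a \o @lshift n 2) q.
  by rewrite /holds /= !eval_rename.
pose e (_ : 'I_1) : equation L (n + 2) :=
  (Var (rshift n ord0), Var (rshift n ord_max)).
have [|b /sat_equations_and_inequations[bS _]] :=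
    compB _ (up @` holds c) _ e; last first.
  by exists (b \o @lshift n 2) => q cq; apply/holds_up/bS; exists q.
move=> T0 finT0 T0T.
(* Only the equations of [T0] are transferred from [C], which may be trivial; resetting the fresh
   variables to [x] and [y] then satisfies the inequation in [B]. *)
have [||b bT0] := @Ucl_satisfiable B C _ (T0 `&` (QEq @` (up @` holds c))) BC.
- exact: finite_setIl.
- exists (extend C c (fun=> c0)) => _ [_ [_ [q cq <-] <-]] /=.
  by apply/holds_up; rewrite extendl.
exists (extend B (b \o @lshift n 2) (fun k => if k == ord0 then x else y)).
move=> phi T0phi; have [[_ [q cq <-] phiE]|[i _ <-]] := T0T _ T0phi.
  rewrite -phiE; apply/holds_up; rewrite extendl; apply/holds_up/(bT0 (QEq _)).
  by split; [rewrite phiE|exists (up q) => //; exists q].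
by rewrite /= /holds /= !extendr.
Qed.

Lemma inequation_compact_coordinate B C :
  inequation_compact B -> Ucl B C -> finitely_generated C ->
  exists (n : nat) (Y : set ('I_n -> B)),
    [/\ algebraic Y, irreducible Y & isomorphic C (coordinate_algebra Y)].
Proof.
move=> compB BC /finitely_generated_eval[n [c gen]].
pose Y := solutions B (holds c); exists n, Y.
have Yne m (e : 'I_m.+1 -> equation L n) : (forall i, ~ holds c (e i)) ->
    exists2 b, Y b & forall i, ~ holds b (e i).
  move=> nce; have [|b /sat_equations_and_inequations[Yb]] := compB n (holds c) m e.
    move=> T0 finT0 T0T; apply: (Ucl_satisfiable BC finT0); exists c => phi T0phi.
    apply: (sat_equations_and_inequations (holds c) e c).2 (T0T _ T0phi).
    by split=> // /sat_disjunction[i /nce].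
  by move/sat_disjunction => nbe; exists b => // i bi; apply: nbe; exists i.
have radE q : radical Y q <-> holds c q.
  split=> [Yq|cq b]; last exact.
  apply: contrapT => ncq; have [|b Yb /(_ ord0)] := Yne 0 (fun=> q) => //.
  by apply; apply: Yq.
split; [by exists (holds c)| |exact: isomorphic_coordinate radE].
split=> [|k Z ZY YE]; first exact: inequation_compact_solution.
(* [Z i] misses a point of [Y], so one of its defining equations fails on [Y]; by [radE] it is false
   at [c]. *)
have sep i : exists q, ~ holds c q /\ forall b, Z i b -> holds b q.
  have [[S ZE] [ZsubY]] := ZY i.
  move=> /existsNP[b /not_implyP[Yb nZb]].
  have [q /not_implyP[Sq nbq]] : exists q, ~ (S q -> holds b q).
    by apply/existsNP; rewrite ZE in nZb.
  exists q; split=> [/(radE q)/(_ b Yb)//|b']; by rewrite ZE; apply.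
have [b0 Yb0] := inequation_compact_solution c compB BC.
(* The empty union is excluded by a point of [Y], since [Yne] takes at least one equation. *)
case: k Z ZY YE sep => [|k] Z ZY YE sep.
  by move: Yb0; rewrite -/Y YE => -[[]].
have [b Yb nbe] := Yne k (fun i => projT1 (cid (sep i)))
  (fun i => (projT2 (cid (sep i))).1).
move: Yb; rewrite YE => -[i _ Zib].
by apply: (nbe i); apply: (projT2 (cid (sep i))).2.
Qed.

Lemma coordinate_Dis B C n (Y : set ('I_n -> B)) :
  irreducible Y -> algebraic Y -> isomorphic C (coordinate_algebra Y) -> Dis B C.
Proof.
move=> [_ Yirr] [S YE] [h [hh hbij]] W finW; apply: contrapT => nodis.
pose pairs := [set p : C * C | [/\ W p.1, W p.2 & p.1 <> p.2]].
have /finite_set_range[k [r rE]] : finite_set pairs.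
  by apply: (sub_finite_set _ (finite_setX finW finW)) => p [].
(* [E i] holds at a point of [Y] exactly when evaluation there identifies the pair [r i]. *)
pose E i : equation L n := (repr (h (r i).1), repr (h (r i).2)).
apply: (Yirr k (fun i => Y `&` solutions B [set E i])) => [i|].
  split; first by exists (S `|` [set E i]); rewrite YE; apply/seteqP; split=> b;
    [move=> [Sb Eb] q []; [apply: Sb|apply: Eb]|
     move=> SEb; split=> q hq; apply: SEb; [left|right]].
  (* If [E i] held on all of [Y], it would be in the radical and the two distinct elements of [r i]
     would coincide. *)
  split=> [b []//|sub].
  have [_ _] : pairs (r i) by rewrite -rE; exists i.
  apply; apply: (bij_inj hbij); rewrite -[LHS]reprK -[RHS]reprK.
  by apply/coordinate_eqP => b Yb; have [_ /(_ (E i) erefl)] := sub b Yb.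
apply/seteqP; split=> [b Yb|b [i _ []]//].
(* Evaluation at a point outside all these subsets separates every pair of distinct elements of
   [W]. *)
apply: contrapT => nb; apply: nodis.
exists ((fun x : coordinate_algebra Y => eval b (repr x)) \o h); split.
  by move=> f a /=; rewrite hh (coordinate_point_hom Yb).
move=> u v; rewrite !inE => Wu Wv /= uv; apply: contrapT => nuv.
have [i _ ri] : range r (u, v) by rewrite rE.
by apply: nb; exists i => //; split=> // _ ->; rewrite /E ri.
Qed.

Lemma Lfg_Dis_inequation_compact B :
  (forall C, Ucl B C -> Lfg (Dis B) C) -> inequation_compact B.
Proof.
move=> BDis n S m e /Ucl_compactness[C BC [c /sat_equations_and_inequations[cS nce]]].
pose D := smallest (@subuniverse L C) (range c).
have cD i : D (c i) by apply: sub_gen_smallest; exists i.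
pose subD : subuniverse D := @smallest_subuniverse _ _ _.
(* There is at least one inequation, and its left side provides an element even when [n] is 0. *)
have D0 : D !=set0 by exists (eval c (e ord0).1); apply: eval_subuniverse.
pose d i : subalgebra subD D0 := exist _ (c i) (cD i).
have satd phi : sat d phi <-> sat c phi.
  exact: iff_sym (sat_substructure d phi).
have disD : Dis B (subalgebra subD D0).
  by apply: BDis => //; apply: finitely_generated_smallest; apply: finite_range.
have [h [hh hinj]] := disD _ (finite_sides d (disjunction e)).
exists (h \o d); apply/sat_equations_and_inequations; split=> [q Sq|].
  by apply: holds_hom => //; apply/(satd (QEq q))/cS.
by rewrite (sat_hom hh hinj) satd.
Qed.

End Classes.

Theorem theorem4p2 (L : language) (B : algebra L) :
  [<->
    u_omega_compact B;
    forall (n : nat) (S : set (equation L n)) (m : nat)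
           (e : 'I_m.+1 -> equation L n),
      consequence B S (disjunction e) ->
      exists Sc : set (equation L n),
        [/\ finite_set Sc, Sc `<=` S & consequence B Sc (disjunction e)];
    (* the finite subsystem S_c is the range of r *)
    forall (n : nat) (S : set (equation L n)) (m : nat)
           (e : 'I_m.+1 -> equation L n),
      (forall b : 'I_n -> B,
         (forall q, S q -> holds b q) -> exists i : 'I_m.+1, holds b (e i)) ->
      exists (k : nat) (r : 'I_k -> equation L n),
        (forall j, S (r j)) /\
        models B (Forall (QImp (conjunction r) (disjunction e)));
    forall (n : nat) (S : set (equation L n)) (m : nat)
           (e : 'I_m.+1 -> equation L n),
      let T := [set QEq q | q in S] `|`
               [set QNot (QEq (e i)) | i in [set: 'I_m.+1]] in
      finitely_satisfiable B T -> satisfiable B T;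
    forall C : algebra L, Ucl B C -> finitely_generated C ->
      exists (n : nat) (Y : set ('I_n -> B)),
        [/\ algebraic Y, irreducible Y & isomorphic C (coordinate_algebra Y)];
    same_class (fg_members (Ucl B)) (fg_members (Dis B));
    same_class (Ucl B) (Lfg (Dis B))].
Proof.
tfae.
- move=> compB n S m e /subset_bigcup_solutions/compB[S0 [finS0 S0S S0e]].
  by exists S0; split=> //; apply/subset_bigcup_solutions.
- move=> compB n S m e Se.
  have [b Sb|S0 [/finite_set_range[k [r <-]] rS re]] := compB n S m e.
    by apply/sat_disjunction/Se.
  exists k, r; split=> [j|b /sat_bigand rb]; first by apply: rS; exists j.
  by apply: re => _ [j _ <-]; apply: rb.
- move=> compB n S m e T finT; apply: contrapT => nT.
  have [b Sb|k [r [rS re]]] := compB n S m e.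
    apply: contrapT => neb; apply: nT; exists b.
    by apply/sat_equations_and_inequations; split=> // /sat_disjunction.
  (* The finite subsystem together with all the inequations is a finite part of [T]; a point
     satisfying it contradicts [re]. *)
  have [||b /sat_equations_and_inequations[rb]] :=
      finT (equations_and_inequations (range r) e).
  + rewrite finite_setU; split; last exact: finite_range.
    exact/finite_image/finite_range.
  + by apply: setSU; apply: image_subset => _ [j _ <-].
  by apply; apply: re; apply/sat_bigand => j; apply: rb; exists j.
- by move=> compB C; apply: inequation_compact_coordinate.
- move=> coordB C; split=> -[BC fgC]; split=> //; last exact: sub_Dis_Ucl.
  have [n [Y [algY irrY isoY]]] := coordB C BC fgC.
  exact: coordinate_Dis irrY algY isoY.
(* [Ucl B] is closed under subalgebras and determined by its finitely generated members. *)
- move=> fgB C; split=> [BC P subP P0 fgP|DC].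
    by have [] := (fgB (subalgebra subP P0)).1 (conj (Ucl_subalgebra BC) fgP).
  by apply: Lfg_Ucl => P subP P0 fgP; apply: sub_Dis_Ucl; apply: DC.
(* The cycle closes by passing through condition 4). *)
- move=> UclE; apply: inequation_compact_u_omega.
  by apply: Lfg_Dis_inequation_compact => C /UclE.
Qed.
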